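(* Let $T$ be a $\beta(1,0)$-tree with $h(T)=T$. Then $T$ has exactly one of the following structures: (F0) $T$ is the one-node tree. (F1) There is a $\beta(1,0)$-tree $A$ such that $T$ is obtained as follows: take $h(A)$, change the label of its root to $1$ (unless it is $1$ already), and attach the root of the result by a new edge as a new rightmost child of the root of $A$; finally set the root label equal to the sum of the labels of its children. (F2) There are a $\beta(1,0)$-tree $A_1$, an integer $b>1$, and a $\beta(1,0)$-tree $A_2$ with at least two nodes, $h(A_2)=A_2$ and $\mathrm{root}(A_2)\ge b-1$, such that $T$ is obtained as follows: attach (the root of) $h(A_1)$ by a new edge as a new rightmost child of the $(b-1)$-th node on the rightmost path of $A_2$ (nodes on this path counted from the root, the root being the first); in the rightmost path of the resulting tree, add $1$ to the label of every non-root node from the $(b-1)$-th node upwards (if any), and set the label of the $b$-th node (the root of the attached copy of $h(A_1)$) to $1$; change the root label to $b$, and call the result $A_2'$. Then attach the root of $A_2'$ by a new edge as a new rightmost child of the root of $A_1$, and set the root label equal to the sum of the labels of its children. In particular, except for the one-node tree, $h$ has no fixed points with an odd number of nodes.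
   Context: A $\beta(1,0)$-tree is a rooted plane tree (the children of each node are linearly ordered from left to right) whose nodes are labeled with positive integers such that: leaves have label $1$; the root has label equal to the sum of its children's labels; every other node has label between $1$ and the sum of its children's labels. (The one-node tree consists of a single node with label $1$.) For a $\beta(1,0)$-tree $T$, $\mathrm{root}(T)$ is the label of the root, the rightmost path is the path from the root obtained by repeatedly passing to the rightmost child until reaching a leaf, and $\mathrm{rpath}(T)$ is the number of edges of the rightmost path. The depth of a node is its distance from the root. The map $h$ on $\beta(1,0)$-trees is defined recursively (it is a well-defined map with $\mathrm{rpath}(h(A))=\mathrm{root}(A)$ for every $A$ with at least two nodes): (i) $h$ maps the one-node tree and the one-edge tree to themselves. (ii) If the root of $T$ has exactly one child $v$, $v$ has label $c$, and $v$ is not a leaf: let $A$ be the subtree rooted at $v$, with the label of $v$ replaced by the sum of the labels of its children. Then $h(T)$ is obtained from $h(A)$ by attaching a new leaf (label $1$) as the new rightmost child of the node at depth $c-1$ on the rightmost path of $h(A)$, and increasing by $1$ the labels of all nodes on the rightmost path above the new leaf (i.e. at depths $0,1,\dots,c-1$). (iii) If the root of $T$ has at least two children: let $A$ be the tree formed by the root and all its subtrees except the rightmost one, with root label equal to the sum of the labels of those children, and let $B$ be the tree formed by the root and its rightmost subtree, with root label equal to the label of the rightmost child. Then $h(T)$ is obtained by identifying the rightmost leaf of $h(B)$ with the root of $h(A)$, the identified node keeping label $1$. *)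

(* Defs.v *)
From mathcomp Require Import all_boot.

Set Implicit Arguments.
Unset Strict Implicit.
Unset Printing Implicit Defensive.

Inductive tree := Node of nat & seq tree.

Definition label (T : tree) : nat := let: Node l _ := T in l.

Definition children (T : tree) : seq tree := let: Node _ ch := T in ch.

Definition sum_labels (s : seq tree) : nat := sumn [seq label v | v <- s].

Fixpoint nodes (T : tree) : nat :=
  let: Node _ ch := T in (sumn [seq nodes v | v <- ch]).+1.

(* The condition on the labels of a subtree rooted at a non-root node. *)
Fixpoint beta_subtree (T : tree) : bool :=
  let: Node l ch := T in
  (if nilp ch then l == 1 else 1 <= l <= sum_labels ch) && all beta_subtree ch.

Definition beta10 (T : tree) : bool :=
  let: Node l ch := T in
  (l == if nilp ch then 1 else sum_labels ch) && all beta_subtree ch.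

Definition one_node : tree := Node 1 [::].

Definition one_edge : tree := Node 1 [:: one_node].

Fixpoint rpath (T : tree) : nat :=
  let: Node _ ch := T in last 0 [seq (rpath v).+1 | v <- ch].

Definition relabel (l : nat) (T : tree) : tree := Node l (children T).

Definition incr_label (T : tree) : tree := relabel (label T).+1 T.

Definition sum_root (T : tree) : tree := relabel (sum_labels (children T)) T.

Definition attach (S T : tree) : tree := Node (label T) (rcons (children T) S).

Fixpoint map_last (X : Type) (f : X -> X) (s : seq X) : seq X :=
  match s with
  | [::] => [::]
  | [:: x] => [:: f x]
  | x :: s' => x :: map_last f s'
  end.

(* Applies f to the subtree rooted at the node at depth d of the rightmost    *)
(* path; does nothing if d > rpath T.                                         *)
Fixpoint on_rpath (d : nat) (f : tree -> tree) (T : tree) : tree :=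
  if d is d'.+1 then Node (label T) (map_last (on_rpath d' f) (children T))
  else f T.

Definition incr_rpath (ds : seq nat) (T : tree) : tree :=
  foldr (fun d => on_rpath d incr_label) T ds.

Definition insert_leaf (c : nat) (T : tree) : tree :=
  incr_rpath (iota 0 c) (on_rpath c.-1 (attach one_node) T).

Definition graft (TB TA : tree) : tree :=
  on_rpath (rpath TB) (fun _ => relabel 1 TA) TB.

(* h does not depend on the root label of its argument, since that label is   *)
(* determined by the children; this allows a structural recursion, in which   *)
(* [h1 v] is the image of the tree whose root has the single child v. The     *)
(* defining clauses of h are the lemmas that follow.                          *)
Fixpoint h (T : tree) : tree :=
  let h1 v :=
    if nilp (children v) then one_edge else insert_leaf (label v) (h v) in
  match T with
  | Node _ [::] => one_node
  | Node _ (v :: s) => foldl (fun TA w => graft (h1 w) TA) (h1 v) s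
  end.

Lemma h_one_node : h one_node = one_node.
Proof. by []. Qed.

Lemma h_one_edge : h one_edge = one_edge.
Proof. by []. Qed.

Lemma h_one_child (r c : nat) (ch : seq tree) : ch <> [::] ->
  h (Node r [:: Node c ch]) = insert_leaf c (h (Node (sum_labels ch) ch)).
Proof. by case: ch. Qed.

Lemma h_rcons (r : nat) (s : seq tree) (v : tree) : s <> [::] ->
  h (Node r (rcons s v)) =
  graft (h (Node (label v) [:: v])) (h (Node (sum_labels s) s)).
Proof. by case: s => [//|u s] _; rewrite /= foldl_rcons. Qed.

Definition fixed_F0 (T : tree) : Prop := T = one_node.

Definition fixed_F1 (T : tree) : Prop :=
  exists2 A : tree, beta10 A & T = sum_root (attach (relabel 1 (h A)) A).

(* The tree A_2'. The k-th node of the rightmost path has depth k - 1, so the *)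
(* non-root nodes from the (b-1)-th one upwards have depths 1, ..., b - 2.    *)
Definition F2_subtree (A1 : tree) (b : nat) (A2 : tree) : tree :=
  relabel b
    (on_rpath b.-1 (relabel 1)
      (incr_rpath (iota 1 (b - 2)) (on_rpath (b - 2) (attach (h A1)) A2))).

Definition fixed_F2 (T : tree) : Prop :=
  exists (A1 : tree) (b : nat) (A2 : tree),
    [/\ beta10 A1, 1 < b,
        [/\ beta10 A2, 1 < nodes A2, h A2 = A2 & b - 1 <= label A2] &
        T = sum_root (attach (F2_subtree A1 b A2) A1)].

(* Main.v *)
Require Import Defs.
From mathcomp Require Import all_boot.
From mathcomp Require Import zify.

Set Implicit Arguments.
Unset Strict Implicit.
Unset Printing Implicit Defensive.

(** Write [plant d S U] for the tree obtained from [U] by attaching [S] as a new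
    rightmost child of the node at depth [d] of the rightmost path and adding 1
    to the labels at depths [0, ..., d].  If [s ++ [v]] are the subtrees of the
    root of [T] and [v] is not a leaf, clauses (ii) and (iii) merge into
    [h T = plant (label v - 1) (h A) (h v)], where [A] has the subtrees [s] and
    [h A] gets root label 1.  Conversely, [h] turns planting into attaching at the root:
    the subtrees of [h (plant d S U)] are those of [h S] followed by [h U] with
    root label [d + 1].
    Let [h T = T] and [c = label v].  If [c = 1], comparing rightmost subtrees
    gives [v = h A] up to the root label, which is (F1).  If [c = d + 2], then
    [v = plant d (h A) w], where [w] is the rightmost subtree of [h v]; by the
    second formula [w] is [h w] with root label [d + 1], so that [w] is, up to
    its root label, a fixed point, which is (F2). *)

(** * Planting, root labels and elementary facts *)

Fixpoint plant (d : nat) (S U : tree) : tree :=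
  if d is d'.+1 then Node (label U).+1 (map_last (plant d' S) (children U))
  else Node (label U).+1 (rcons (children U) S).

(** The root gets the only label that [beta10] allows; the empty sum would give 0 instead of 1. *)
Definition root_join (s : seq tree) : tree :=
  Node (if nilp s then 1 else sum_labels s) s.

Lemma map_last_rcons (X : Type) (f : X -> X) s x : map_last f (rcons s x) = rcons s (f x).
Proof. by elim: s => //= y s ->; case: s. Qed.

Lemma map_last_comp (X : Type) (f g : X -> X) s : map_last f (map_last g s) = map_last (f \o g) s.
Proof. by case/lastP: s => // s x; rewrite !map_last_rcons. Qed.

Lemma map_last_id (X : Type) (s : seq X) : map_last id s = s.
Proof. by case/lastP: s => // s x; rewrite map_last_rcons. Qed.

Lemma eq_map_last (X : Type) (f g : X -> X) : f =1 g -> map_last f =1 map_last g.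
Proof. by move=> fg s; case/lastP: s => // s x; rewrite !map_last_rcons fg. Qed.

Lemma rpath_rcons l s x : rpath (Node l (rcons s x)) = (rpath x).+1.
Proof. by rewrite /= map_rcons last_rcons. Qed.

Lemma sum_labels_rcons s x : sum_labels (rcons s x) = sum_labels s + label x.
Proof. by rewrite /sum_labels map_rcons -cats1 sumn_cat /= addn0. Qed.

Lemma nodes_rcons l s x :
  nodes (Node l (rcons s x)) = nodes (Node l s) + nodes x.
Proof. by rewrite /= map_rcons -cats1 sumn_cat /= addn0 addSn. Qed.

Lemma nilp_rcons (s : seq tree) x : nilp (rcons s x) = false.
Proof. by case: s. Qed.

Lemma beta10_root_join T :
  beta10 T = (label T == label (root_join (children T)))
             && all beta_subtree (children T).
Proof. by case: T. Qed.

Lemma beta10_eta T : beta10 T -> T = root_join (children T).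
Proof. by case: T => l ch /andP[/eqP-> _]. Qed.

Lemma root_join_beta10 s : all beta_subtree s -> beta10 (root_join s).
Proof. by move=> bs; rewrite /= eqxx. Qed.

Lemma beta10_children T : beta10 T -> all beta_subtree (children T).
Proof. by case: T => l ch /andP[]. Qed.

Lemma beta_subtree_children T : beta_subtree T -> all beta_subtree (children T).
Proof. by case: T => l ch /andP[]. Qed.

Lemma beta_subtree_label_gt0 T : beta_subtree T -> 0 < label T.
Proof. by case: T => l [|a ch] /andP[] => [/eqP->|/andP[]]. Qed.

Lemma beta_subtree_label_le T : beta_subtree T -> children T <> [::] ->
  label T <= sum_labels (children T).
Proof. by case: T => l [|a ch] // /andP[/andP[]]. Qed.

Lemma beta_subtree_relabel1 T : beta10 T -> beta_subtree (relabel 1 T).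
Proof.
case: T => l [|a ch] //= /and3P[_ ba bch]; rewrite ba bch !andbT.
by rewrite /sum_labels /=; move: (beta_subtree_label_gt0 ba); lia.
Qed.

Lemma h_children T U : children T = children U -> h T = h U.
Proof. by case: T => l s; case: U => l' s' /= ->. Qed.

(** * Labels, path length and node count under planting *)

Lemma relabel_plant l l' d S U :
  relabel l (plant d S (relabel l' U)) = relabel l (plant d S U).
Proof. by case: d. Qed.

Lemma label_plant d S U : label (plant d S U) = (label U).+1.
Proof. by case: d. Qed.

Lemma plant_rcons d S l s x :
  plant d.+1 S (Node l (rcons s x)) = Node l.+1 (rcons s (plant d S x)).
Proof. by rewrite /= map_last_rcons. Qed.

Lemma children_plant_neq0 d S U : d <= rpath U -> children (plant d S U) <> [::].
Proof.
case: d => [|d] /=; first by case: (children U).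
case: U => l; case/lastP => //= s x _.
by rewrite map_last_rcons; case: s.
Qed.

Lemma sum_labels_plant d S U : d < rpath U -> label S = 1 ->
  sum_labels (children (plant d S U)) = (sum_labels (children U)).+1.
Proof.
case: d => [_|d] S1 /=; first by rewrite sum_labels_rcons S1 addn1.
case: U S1 => l; case/lastP => //= s x _ _.
by rewrite map_last_rcons !sum_labels_rcons label_plant addnS.
Qed.

Lemma rpath_plant d S U : d <= rpath U -> rpath (plant d S U) = d + (rpath S).+1.
Proof.
elim: d U => [|d IH] [l ch]; first by rewrite [plant _ _ _]/= rpath_rcons.
case/lastP: ch => // s x; rewrite plant_rcons !rpath_rcons ltnS => /IH ->.
by rewrite addSn.
Qed.

Lemma nodes_plant d S U : d <= rpath U -> nodes (plant d S U) = nodes S + nodes U.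
Proof.
elim: d U => [|d IH] [l ch].
  by rewrite [plant _ _ _]/= nodes_rcons /= addnC.
case/lastP: ch => // s x; rewrite plant_rcons rpath_rcons ltnS => /IH Hx.
by rewrite !nodes_rcons Hx /=; lia.
Qed.

(** Along the path each label and the sum of its children's labels both grow by 1. The bound on [d]
    is strict because a non-root leaf receiving [S] would get label 2 over a single child of label
    1. *)
Lemma beta_children_plant d S U : d < rpath U ->
  all beta_subtree (children U) -> beta_subtree S -> label S = 1 ->
  all beta_subtree (children (plant d S U)).
Proof.
elim: d U => [|d IH] [l ch] dU bU bS S1; first by rewrite /= all_rcons bS.
case/lastP: ch dU bU => // s x; rewrite rpath_rcons ltnS => dx.
rewrite plant_rcons /= !all_rcons => /andP[bx ->]; rewrite andbT.
have := IH x dx (beta_subtree_children bx) bS S1.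
have := sum_labels_plant dx S1; have := label_plant d S x.
have := children_plant_neq0 (S := S) (ltnW dx).
have := beta_subtree_label_le bx.
case: (plant d S x) => l' [|a ch] //= le_x _ -> -> ->; rewrite andbT ltnS.
by apply: le_x => x0; case: x dx x0 {IH bx} => ? [].
Qed.

Lemma beta10_plant d S U : d < rpath U -> beta10 U -> beta_subtree S ->
  label S = 1 -> beta10 (plant d S U).
Proof.
move=> dU bU bS S1; rewrite beta10_root_join.
rewrite (beta_children_plant dU (beta10_children bU) bS S1) andbT.
rewrite label_plant /root_join /=.
have := children_plant_neq0 (S := S) (ltnW dU).
rewrite sum_labels_plant //; case: (children _) => //= _ _ _.
by case: U dU bU => l [|a ch] //= _ /andP[/eqP->].
Qed.

(** * Leaf insertion, grafting and (F2) expressed by planting *)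

Lemma incr_rpath_succ ds l s :
  incr_rpath [seq d.+1 | d <- ds] (Node l s) = Node l (map_last (incr_rpath ds) s).
Proof.
elim: ds => [|d ds IH] /=; first by rewrite map_last_id.
by rewrite -/(incr_rpath _ _) IH /= map_last_comp.
Qed.

Lemma incr_rpath_attach d S U :
  incr_rpath (iota 0 d.+1) (on_rpath d (attach S) U) = plant d S U.
Proof.
elim: d U => [//|d IH] U.
have -> : iota 0 d.+2 = 0 :: [seq i.+1 | i <- iota 0 d.+1].
  by rewrite -[map _ _]/(map (addn 1) _) -iotaDl.
transitivity (incr_label (incr_rpath [seq i.+1 | i <- iota 0 d.+1]
                (Node (label U) (map_last (on_rpath d (attach S)) (children U))))).
  by [].
rewrite incr_rpath_succ map_last_comp /incr_label /relabel.
by congr Node; apply: eq_map_last => x; apply: IH.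
Qed.

Lemma insert_leafE c U : insert_leaf c.+1 U = plant c one_node U.
Proof. exact: incr_rpath_attach. Qed.

Lemma relabel_planted l d S U :
  on_rpath d.+1 (relabel l) (plant d S U) = plant d (relabel l S) U.
Proof.
elim: d U => [|d IH] U; first by rewrite /= map_last_rcons.
rewrite [LHS]/= map_last_comp /=; congr Node.
by apply: eq_map_last => x; apply: IH.
Qed.

(** Here b = d + 2. Planting also raises the label at depth 0, but the outer [relabel] overwrites
    it. *)
Lemma F2_subtreeE A d U :
  F2_subtree A d.+2 U = relabel d.+2 (plant d (relabel 1 (h A)) U).
Proof.
by rewrite -relabel_planted -incr_rpath_attach /F2_subtree subn2 /=.
Qed.

(** The planted leaf ends the new rightmost path, so grafting replaces exactly this leaf. *)
Lemma graft_plant d A U : d <= rpath U ->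
  graft (plant d one_node U) A = plant d (relabel 1 A) U.
Proof.
move=> dU; rewrite /graft rpath_plant // addn1.
elim: d U dU => [|d IH] [l ch]; first by rewrite /= map_last_rcons.
case/lastP: ch => // s x; rewrite rpath_rcons ltnS => dx.
by rewrite !plant_rcons /= map_last_rcons -IH.
Qed.

(** * The map [h] in terms of planting *)

Lemma h_rcons_leaf r s v : children v = [::] ->
  h (Node r (rcons s v)) = Node 1 [:: relabel 1 (h (root_join s))].
Proof.
move=> v0; have h1v l : h (Node l [:: v]) = one_edge by rewrite /= v0.
case/lastP: s => [|s u]; first by rewrite h1v.
by rewrite h_rcons ?h1v //; case: s.
Qed.

(** For empty [s] this is clause (ii), as [root_join [::]] is the one-node tree, fixed by [h]. The
    bound on [c] is a hypothesis because [h_spec] establishes it by an induction that uses this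
    formula. *)
Lemma h_rcons_node r s v c : children v <> [::] -> label v = c.+1 ->
    c <= rpath (h v) ->
  h (Node r (rcons s v)) = plant c (relabel 1 (h (root_join s))) (h v).
Proof.
move=> v0 vc cv.
have h1v l : h (Node l [:: v]) = plant c one_node (h v).
  case: v v0 vc cv => lv [|a ch] // _ /= -> cv.
  exact: insert_leafE.
case/lastP: s => [|s u]; first exact: h1v.
rewrite h_rcons ?h1v ?graft_plant //; by case: s.
Qed.

(* The root label is irrelevant, so that the induction applies to subtrees. *)
Lemma h_spec T : all beta_subtree (children T) ->
  [/\ beta10 (h T), nodes (h T) = nodes T
    & children T <> [::] -> rpath (h T) = sum_labels (children T)].
Proof.
(* [root_join s] is not a subtree of [T], hence induction on the number of nodes. *)
have [n] := ubnP (nodes T); elim: n T => // n IH [r ch].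
case/lastP: ch => [//|s v]; rewrite nodes_rcons [children _]/= all_rcons => leTn.
case/andP=> bv bs.
have nv : 0 < nodes v by case: (v).
have [|bhs nhs rhs] := IH (root_join s) _ bs; first by move: leTn; rewrite /=; lia.
have [|bhv nhv rhv] := IH v _ (beta_subtree_children bv).
  by move: leTn; rewrite /=; lia.
have rs : rpath (h (root_join s)) = sum_labels s.
  by case: (s) rhs => //= a s' ->.
have rr : rpath (relabel 1 (h (root_join s))) = sum_labels s.
  by rewrite -rs; case: (h _).
have nr : nodes (relabel 1 (h (root_join s))) = nodes (Node r s).
  by transitivity (nodes (h (root_join s))); [case: (h _) | rewrite nhs].
have br := beta_subtree_relabel1 bhs.
have [v0 | v0] : children v = [::] \/ children v <> [::].
  by case: (children v) => [|a l]; [left | right].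
  rewrite h_rcons_leaf // sum_labels_rcons.
  have [lv1 nv1] : label v = 1 /\ nodes v = 1.
    by case: v v0 bv {nv nhv rhv bhv leTn} => l [] //= _ /andP[/eqP->].
  split; rewrite ?lv1 ?nv1 //.
  - by rewrite -[beta10 _]/(beta_subtree (relabel 1 (h (root_join s))) && true) br.
  - by rewrite -nr /= addn0 addn1.
  - by move=> _; rewrite -[LHS]/(rpath (relabel 1 (h (root_join s)))).+1 rr addn1.
have := beta_subtree_label_gt0 bv; case lv: (label v) => [//|c] _.
(* The label c + 1 of [v] is at most the sum of its children's labels, which is [rpath (h v)] by
   induction. *)
have cv : c < rpath (h v).
  by rewrite (rhv v0) -lv; apply: beta_subtree_label_le.
rewrite (h_rcons_node _ _ v0 lv (ltnW cv)); split.
- exact: beta10_plant.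
- by rewrite nodes_plant ?nr ?nhv // ltnW.
- by rewrite rpath_plant ?rr ?sum_labels_rcons ?lv 1?ltnW //; lia.
Qed.

Lemma beta10_h T : all beta_subtree (children T) -> beta10 (h T).
Proof. by case/h_spec. Qed.

Lemma nodes_h T : beta10 T -> nodes (h T) = nodes T.
Proof. by move/beta10_children/h_spec => []. Qed.

Lemma rpath_h T : all beta_subtree (children T) -> children T <> [::] ->
  rpath (h T) = sum_labels (children T).
Proof. by case/h_spec. Qed.

(** For d = 0 the last subtree is [S] with label 1, so [h U] is attached at the root of [h S].
    Otherwise the last subtree of [U] has its label raised by 1, so [h] plants one level deeper,
    inside the last subtree provided by induction; this rebuilds [h U] there and turns the label d
    into d + 1. *)
Lemma children_h_plant d S U : d < rpath U ->
    all beta_subtree (children U) -> beta10 S ->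
  children (h (plant d (relabel 1 S) U)) =
    rcons (children (h S)) (relabel d.+1 (h U)).
Proof.
move=> + + bS; elim: d U => [|d IH] [l ch] dU bU.
  have hU : h (root_join ch) = h (Node l ch) by apply: h_children.
  have [S0|S0] : children S = [::] \/ children S <> [::].
    by case: (children S) => [|a t]; [left | right].
    rewrite [plant _ _ _]/= h_rcons_leaf // hU.
    by case: (S) S0 => ? [].
  rewrite [plant _ _ _]/= (@h_rcons_node _ _ _ 0) // hU.
  by rewrite (@h_children (relabel 1 S) S).
case/lastP: ch dU bU => // s x; rewrite rpath_rcons ltnS => dx.
rewrite plant_rcons [children (Node l (rcons s x))]/= all_rcons => /andP[bx bs].
have x0 : children x <> [::] by case: (x) dx => ? [].
have bS1 := beta_subtree_relabel1 bS.
have bxc := beta_subtree_children bx.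
have := beta_subtree_label_gt0 bx; case lx: (label x) => [//|e] _.
have ex : e < rpath (h x) by rewrite rpath_h // -lx beta_subtree_label_le.
have p0 := children_plant_neq0 (S := relabel 1 S) (ltnW dx).
rewrite (@h_rcons_node _ _ _ e.+1) ?label_plant ?lx //; last first.
  by rewrite rpath_h ?beta_children_plant // sum_labels_plant // -rpath_h // ltnW.
rewrite (@h_rcons_node _ _ _ e) // 1?ltnW //.
case: (h (plant _ _ _)) (IH x dx bxc) => l' ch' /= ->.
by rewrite map_last_rcons; case: (e).
Qed.

(** * The structure of fixed points *)

Lemma fixed_point_F1_or_F2 T : beta10 T -> h T = T -> T <> one_node ->
  fixed_F1 T \/ fixed_F2 T.
Proof.
case: T => r ch; case/lastP: ch => [|s v] bT hT T1.
  by case: T1; move/andP: bT => [/eqP-> _].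
have := bT; rewrite [beta10 _]/= nilp_rcons all_rcons => /andP[/eqP rE /andP[bv bs]].
have bA := root_join_beta10 bs.
have F1 : v = relabel 1 (h (root_join s)) -> fixed_F1 (Node r (rcons s v)).
  by move=> vE; exists (root_join s); rewrite // -vE rE.
have [v0|v0] : children v = [::] \/ children v <> [::].
  by case: (children v) => [|a l]; [left | right].
  left; apply: F1; move: hT; rewrite h_rcons_leaf // => -[_].
  by rewrite -[[:: _]]/(rcons [::] _) => /rcons_inj[].
have bvc := beta_subtree_children bv.
have := beta_subtree_label_gt0 bv; case lv: (label v) => [//|c] _.
have cv : c < rpath (h v) by rewrite rpath_h // -lv beta_subtree_label_le.
move: hT; rewrite (h_rcons_node _ _ v0 lv (ltnW cv)).
case: c lv cv => [|d] lv cv; first by case=> _ /rcons_inj[_ vE]; left; apply: F1.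
have := beta10_h bvc.
case hv: (h v) cv => [l ch]; case/lastP: ch hv => // s' w hv.
rewrite rpath_rcons ltnS plant_rcons => dw bhv [_ /rcons_inj[_ vE]].
have bw : beta_subtree w.
  by move: (beta10_children bhv); rewrite /= all_rcons => /andP[].
have bwc := beta_subtree_children bw.
have w0 : children w <> [::] by case: (w) dw => ? [].
have lw : label w = d.+1 by move: lv; rewrite -vE label_plant => -[].
have : children (h v) = rcons s' w by rewrite hv.
rewrite -{1}vE children_h_plant //; last exact: (@beta10_h (root_join s)).
move=> /rcons_inj[_ wE].
have A2E : root_join (children w) = sum_root w.
  by rewrite /root_join /sum_root /relabel; case: (children w) w0.
(* b is the label of [v]. Since [w] equals [h w] only up to the root label, A2 is [w] with that
   label reset to the sum; this sum is at least the old label d + 1 = b - 1. *)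
right; exists (root_join s), d.+2, (sum_root w); split=> //.
  split.
  - by rewrite -A2E; apply: root_join_beta10.
  - by case: (w) w0 => lw' [|[]].
  - rewrite (@h_children (sum_root w) w) // [LHS]beta10_eta ?beta10_h //.
    by rewrite -A2E -[in RHS]wE.
  - by rewrite subn1 /= -lw beta_subtree_label_le.
rewrite F2_subtreeE /sum_root relabel_plant.
have -> : relabel d.+2 (plant d (relabel 1 (h (root_join s))) w) = v.
  by rewrite vE -lv; case: (v).
by rewrite rE.
Qed.

(** * Exclusiveness of the three forms, and parity *)

Lemma not_F0_attach S A : ~ fixed_F0 (sum_root (attach S A)).
Proof. by case: A => l [|a s] []. Qed.

(** The last subtree of the root has label 1 in (F1) and b > 1 in (F2). *)
Lemma F1_not_F2 T : fixed_F1 T -> ~ fixed_F2 T.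
Proof.
case=> A _ -> [A1 [b [A2 [_ b1 _ [_ /rcons_inj[_ E]]]]]].
by move: b1; rewrite -E.
Qed.

Lemma nodes_sum_root_attach S A : nodes (sum_root (attach S A)) = nodes A + nodes S.
Proof. by case: A => l s; rewrite nodes_rcons. Qed.

Lemma nodes_relabel l T : nodes (relabel l T) = nodes T.
Proof. by case: T. Qed.

(** As [h] preserves the number of nodes, (F1) gives twice [nodes A], and (F2) gives twice
    [nodes A1] plus [nodes A2], where A2 is a smaller fixed point with at least two nodes. *)
Lemma fixed_point_even_nodes T : beta10 T -> h T = T -> T <> one_node ->
  ~~ odd (nodes T).
Proof.
have [n] := ubnP (nodes T); elim: n T => // n IH T leTn bT hT T1.
case: (fixed_point_F1_or_F2 bT hT T1) => [[A bA ->]|].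
  by rewrite nodes_sum_root_attach nodes_relabel nodes_h // oddD addbb.
case=> A1 [b [A2 [bA1 b1 [bA2 nA2 hA2 bleA2] TE]]].
case: b b1 bleA2 TE => [|[|d]] // _; rewrite subn1 /= => dA2 TE.
(* As A2 is fixed, its path length is its root label, so the depth d = b - 2 occurs on its rightmost
   path. *)
have rA2 : rpath A2 = label A2.
  rewrite -[in LHS]hA2 rpath_h ?beta10_children //.
    by case: (A2) bA2 nA2 => l [|a s] //= /andP[/eqP-> _].
  by case: (A2) nA2 => l [].
move: leTn; rewrite TE nodes_sum_root_attach F2_subtreeE nodes_relabel.
rewrite nodes_plant ?rA2 ?(ltnW dA2) // nodes_relabel nodes_h // => leTn.
rewrite !oddD addbA addbb addFb; apply: IH => //.
  have nA1 : 0 < nodes A1 by case: (A1).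
  by lia.
by move=> A21; rewrite A21 in nA2.
Qed.

Theorem theorem3 :
  (forall T : tree, beta10 T -> h T = T ->
     [\/ [/\ fixed_F0 T, ~ fixed_F1 T & ~ fixed_F2 T],
         [/\ ~ fixed_F0 T, fixed_F1 T & ~ fixed_F2 T]
       | [/\ ~ fixed_F0 T, ~ fixed_F1 T & fixed_F2 T]]) /\
  (forall T : tree, beta10 T -> h T = T -> T <> one_node -> ~~ odd (nodes T)).
Proof.
split=> [T bT hT|]; last exact: fixed_point_even_nodes.
have F10 : fixed_F1 T -> ~ fixed_F0 T.
  by case=> A _ ->; apply: not_F0_attach.
have F20 : fixed_F2 T -> ~ fixed_F0 T.
  by case=> A1 [b [A2 [_ _ _ ->]]]; apply: not_F0_attach.
have [T1|T1] : T = one_node \/ T <> one_node.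
  by case: (T) => [[|[|l]] [|a s]]; (by left) || by right.
  by apply: Or31; split=> // [/F10|/F20].
case: (fixed_point_F1_or_F2 bT hT T1) => [F1|F2].
  by apply: Or32; split=> //; apply: F1_not_F2.
by apply: Or33; split=> // /F1_not_F2.
Qed.
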